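(* In the setting described in the context, assume that the system $\frac{\mathrm dy}{\mathrm dt}=X(y):=Ay+B(y,y)+F$ on $\mathbb C^N$, with $B$ a bilinear map (so that the nonlinearity $G(y)=B(y,y)$ is quadratic), admits an invariant probability measure $\mu$ that is physically relevant (in the sense of the context), and that $$\int_{E_{\mathfrak c}\times E_{\mathfrak s}}\|\zeta\|^2\,\mathrm d\mu(\xi,\zeta)<\infty.$$ Let $\Psi^\ast(\xi)=\int_{E_{\mathfrak s}}\zeta\,\mathrm d\mu_\xi(\zeta)$ (the optimal parameterizing manifold, i.e. the unique minimizer over $\Psi\in L^2_{\mathfrak m}(E_{\mathfrak c};E_{\mathfrak s})$ of $\int\|\zeta-\Psi(\xi)\|^2\,\mathrm d\mu(\xi,\zeta)$). Then the conditional expectation $\mathbb E_\mu[X|\Pi_{\mathfrak c}]$ satisfies, for ($\mathfrak m$-a.e.) $\xi\in E_{\mathfrak c}$, $$\mathbb E_\mu[X|\Pi_{\mathfrak c}](\xi)=A_{\mathfrak c}\xi+\Pi_{\mathfrak c}B(\xi,\xi)+\Pi_{\mathfrak c}\big(B(\xi,\Psi^\ast(\xi))+B(\Psi^\ast(\xi),\xi)\big)+F_{\mathfrak c}+\eta(\xi),$$ where $$\eta(\xi)=\int_{\zeta\in E_{\mathfrak s}}\Pi_{\mathfrak c}B(\zeta,\zeta)\,\mathrm d\mu_\xi(\zeta).$$ Thus, in the case $\eta=0$, the optimal parameterizing manifold $\Psi^\ast$ provides the conditional expectation: $$\mathbb E_\mu[X|\Pi_{\mathfrak c}](\xi)=A_{\mathfrak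 c}\xi+\Pi_{\mathfrak c}B(\xi,\xi)+\Pi_{\mathfrak c}\big(B(\xi,\Psi^\ast(\xi))+B(\Psi^\ast(\xi),\xi)\big)+F_{\mathfrak c}.$$
   Context: $A$ is an $N\times N$ complex matrix and $F\in\mathbb C^N$ is constant. The vector field $X$ is assumed dissipative so that its flow $T_t$ on $\mathbb C^N$ is well defined. The eigenvalues $\beta_1,\dots,\beta_N$ of $A$ (with algebraic multiplicity), with generalized eigenvectors $\boldsymbol e_1,\dots,\boldsymbol e_N$ forming a basis of $\mathbb C^N$, are ordered so that real parts decrease with the index (ties: imaginary parts decrease). $m$ is such that $1\le m<N$ and $\mathrm{Re}(\beta_m)>\mathrm{Re}(\beta_{m+1})$. $E_{\mathfrak c}=\mathrm{span}\{\boldsymbol e_1,\dots,\boldsymbol e_m\}$ and $E_{\mathfrak s}=\mathrm{span}\{\boldsymbol e_{m+1},\dots,\boldsymbol e_N\}$, so $\mathbb C^N=E_{\mathfrak c}\oplus E_{\mathfrak s}$, identified with $E_{\mathfrak c}\times E_{\mathfrak s}$ via $y=\xi+\zeta\leftrightarrow(\xi,\zeta)$. $\Pi_{\mathfrak c},\Pi_{\mathfrak s}$ are the canonical projectors, $A_{\mathfrak c}=\Pi_{\mathfrak c}A$ and $F_{\mathfrak c}=\Pi_{\mathfrak c}F$. Physically relevant measure: $\mu$ is a probability measure invariant under $T_t$, and there is a set $B(\mu)\subset\mathbb C^N$ of positive Lebesgue measure such that $\lim_{T\to\infty}\frac1T\int_0^T\varphi(T_t(y))\,\mathrm dt=\int\varphi\,\mathrm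 d\mu$ for (a.e.) $y\in B(\mu)$. This is assumed not only for every continuous observable $\varphi$ but for every $\varphi\in L^1_\mu(\mathbb C^N)$ (the exceptional Lebesgue-null set may depend on $\varphi$). $\mathfrak m$ is the push-forward of $\mu$ by $\Pi_{\mathfrak c}$. $L^2_{\mathfrak m}(E_{\mathfrak c};E_{\mathfrak s})$ is the space of measurable $\Psi:E_{\mathfrak c}\to E_{\mathfrak s}$ with $\int\|\Psi\|^2\,\mathrm d\mathfrak m<\infty$. $\{\mu_\xi\}_{\xi\in E_{\mathfrak c}}$ is the disintegration of $\mu$ with respect to $\Pi_{\mathfrak c}$: the ($\mathfrak m$-a.e. uniquely determined) family of probability measures on $E_{\mathfrak s}$ with $\mu(U\times C)=\int_U\mu_\xi(C)\,\mathrm d\mathfrak m(\xi)$ for Borel $U\subset E_{\mathfrak c}$, $C\subset E_{\mathfrak s}$. The conditional expectation of the vector field, as a vector field on the reduced state space $E_{\mathfrak c}$, is $\mathbb E_\mu[X|\Pi_{\mathfrak c}](\xi)=\int_{E_{\mathfrak s}}\Pi_{\mathfrak c}X(\xi+\zeta)\,\mathrm d\mu_\xi(\zeta)$. *)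

(* Defs.v *)
From HB Require Import structures.
From mathcomp Require Import all_boot all_order all_algebra sesquilinear.
From mathcomp Require Import all_classical all_reals all_analysis.
From mathcomp Require Import measurable_realfun complex.

Set Implicit Arguments.
Unset Strict Implicit.
Unset Printing Implicit Defensive.

Import Order.TTheory GRing.Theory Num.Theory.
Import numFieldNormedType.Exports.

Local Open Scope classical_set_scope.
Local Open Scope ring_scope.
Local Open Scope complex_scope.

(* The 2N real coordinates of y in C^N: the real part of y_i is indexed by
   (i, false), its imaginary part by (i, true). *)
Definition rcoord (R : realType) (N : nat) (k : 'I_N * bool)
    (y : 'cV[R[i]]_N) : R :=
  if k.2 then complex.Im (y k.1 0) else complex.Re (y k.1 0).

Definition cnorm (R : realType) (N : nat) (y : 'cV[R[i]]_N) : R :=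
  Num.sqrt (\sum_(k : 'I_N * bool) rcoord k y ^+ 2).

(* The Borel sigma-algebra of C^N, as the product sigma-algebra of R^{2N}. *)
Definition cvec_borel (R : realType) (N : nat) : set_system 'cV[R[i]]_N :=
  <<s \bigcup_(k in [set: 'I_N * bool])
        preimage_set_system setT (@rcoord R N k) measurable >>.

HB.instance Definition _ (R : realType) := isPointed.Build R[i] 0.

Fact cvec_display : measure_display.
Proof. exact: default_measure_display. Qed.

Section cvec_measurable.
Variables (R : realType) (N : nat).

Let cvec0 : @cvec_borel R N set0.
Proof. exact: sigma_algebra0. Qed.

Let cvecC A : @cvec_borel R N A -> @cvec_borel R N (~` A).
Proof. exact: sigma_algebraC. Qed.

Let cvecU (F : (set 'cV[R[i]]_N)^nat) : (forall k, @cvec_borel R N (F k)) ->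
  @cvec_borel R N (\bigcup_k F k).
Proof. exact: sigma_algebra_bigcup. Qed.

HB.instance Definition _ := @isMeasurable.Build cvec_display
  'cV[R[i]]_N (@cvec_borel R N) cvec0 cvecC cvecU.

End cvec_measurable.

(* A subspace V of C^N carries the trace of the Borel sigma-algebra of C^N. *)
Fact subvs_display : measure_display.
Proof. exact: default_measure_display. Qed.

Section subvs_measurable.
Variables (R : realType) (N : nat) (V : {vspace 'cV[R[i]]_N}).

Definition subvs_borel : set_system (subvs_of V) :=
  preimage_set_system setT (vsval : subvs_of V -> 'cV[R[i]]_N) measurable.

Let subvs_sigma : sigma_algebra setT subvs_borel.
Proof. exact/sigma_algebra_preimage/sigma_algebra_measurable. Qed.

Let subvs0 : subvs_borel set0.
Proof. by case: subvs_sigma. Qed.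

Let subvsC A : subvs_borel A -> subvs_borel (~` A).
Proof. by case: subvs_sigma => _ + _ => /[apply]; rewrite setTD. Qed.

Let subvsU (F : (set (subvs_of V))^nat) : (forall k, subvs_borel (F k)) ->
  subvs_borel (\bigcup_k F k).
Proof. by case: subvs_sigma => _ _; exact. Qed.

HB.instance Definition _ := isPointed.Build (subvs_of V) 0.

HB.instance Definition _ := @isMeasurable.Build subvs_display
  (subvs_of V) subvs_borel subvs0 subvsC subvsU.

End subvs_measurable.

Section measurability.
Variables (R : realType) (N : nat).

Lemma measurable_rcoord (k : 'I_N * bool) :
  measurable_fun [set: 'cV[R[i]]_N] (@rcoord R N k).
Proof.
by move=> _ B mB; apply: sub_sigma_algebra; exists k => //; exists B.
Qed.

Lemma measurable_cvecP d (T : measurableType d) (f : T -> 'cV[R[i]]_N) :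
  (forall k, measurable_fun [set: T] (fun x => rcoord k (f x))) ->
  measurable_fun [set: T] f.
Proof.
move=> mf; apply: (@measurability _ _ _ _ _ f
  (\bigcup_(k in [set: 'I_N * bool])
     preimage_set_system setT (@rcoord R N k) measurable)) => //.
move=> _ [_ [k _ [B mB <-]]] <-; rewrite [X in _ @^-1` X]setTI.
exact: (mf k measurableT B mB).
Qed.

Lemma measurable_linear (f : {linear 'cV[R[i]]_N -> 'cV[R[i]]_N}) :
  measurable_fun setT f.
Proof.
apply: measurable_cvecP => -[i b].
have fE y : f y = \sum_j y j 0 *: f (delta_mx j 0).
  rewrite {1}[y]matrix_sum_delta linear_sum; apply: eq_bigr => j _.
  by rewrite big_ord1 linearZ.
have ReE (s : 'I_N -> R[i]) :
    complex.Re (\sum_j s j) = \sum_j complex.Re (s j).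
  by apply: (big_morph _ _ erefl) => -[? ?] [? ?].
have ImE (s : 'I_N -> R[i]) :
    complex.Im (\sum_j s j) = \sum_j complex.Im (s j).
  by apply: (big_morph _ _ erefl) => -[? ?] [? ?].
have -> : (fun y => rcoord (i, b) (f y)) = (fun y => \sum_j
    (let a := f (delta_mx j 0) i 0 in
     if b then rcoord (j, false) y * complex.Im a +
               rcoord (j, true) y * complex.Re a
     else rcoord (j, false) y * complex.Re a -
          rcoord (j, true) y * complex.Im a)).
  apply/funext => y; rewrite /rcoord /= fE summxE.
  case: b; rewrite ?ReE ?ImE; apply: eq_bigr => j _; rewrite mxE;
  by case: (y j 0) => ? ?; case: (f _ _ _).
apply: measurable_sum => j /=.
by case: b; [apply: measurable_funD|apply: measurable_funB];
  apply: measurable_funM => //; exact: measurable_rcoord.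
Qed.

End measurability.

(* The projector of C^N onto U along W, for C^N the direct sum of U and W. *)
Definition proj (R : realType) (N : nat) (U W : {vspace 'cV[R[i]]_N})
    (y : 'cV[R[i]]_N) : subvs_of U := vsproj U (daddv_pi U W y).

Section proj_measurable.
Variables (R : realType) (N : nat) (U W : {vspace 'cV[R[i]]_N}).

Lemma measurable_proj : measurable_fun setT (proj U W).
Proof.
move=> _ _ [B mB <-]; rewrite !setTI.
have := @measurable_linear R N (vsval \o (vsproj U \o daddv_pi U W)).
by move=> /(_ measurableT B mB); rewrite setTI.
Qed.

HB.instance Definition _ := isMeasurableFun.Build _ _ _ _
  (proj U W) measurable_proj.

End proj_measurable.

(* Componentwise (Bochner) integrals. The integral of a V-valued function is
   computed in C^N; it lies in V, so that vsproj V is the identity on it,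
   whenever the function is integrable. *)
Section vector_integral.
Context d (T : measurableType d) (R : realType) (N : nat).
Variable mu : {measure set T -> \bar R}.

Definition cint (f : T -> 'cV[R[i]]_N) : 'cV[R[i]]_N :=
  \col_i ((\int[mu]_x rcoord (i, false) (f x)) +i*
          (\int[mu]_x rcoord (i, true) (f x))).

Variable V : {vspace 'cV[R[i]]_N}.

Definition vintegrable (f : T -> subvs_of V) : Prop :=
  forall k, mu.-integrable setT (fun x => (rcoord k (vsval (f x)))%:E).

Definition vint (f : T -> subvs_of V) : subvs_of V :=
  vsproj V (cint (fun x => vsval (f x))).

End vector_integral.

Section lebesgue.
Variables (R : realType) (N : nat).
Implicit Types (a b : 'I_N * bool -> R) (S : set 'cV[R[i]]_N).

Definition cbox a b : set 'cV[R[i]]_N :=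
  [set y | forall k, a k <= rcoord k y <= b k].

Definition box_volume a b : R := \prod_k Num.max 0 (b k - a k).

(* Lebesgue outer measure on C^N = R^{2N}; its restriction to the
   Caratheodory-measurable sets is Lebesgue measure. *)
Definition lebesgue_outer S : \bar R :=
  ereal_inf [set (\sum_(0 <= j <oo) (box_volume (ab j).1 (ab j).2)%:E)%E
    | ab in [set ab : nat -> ('I_N * bool -> R) * ('I_N * bool -> R)
            | S `<=` \bigcup_j cbox (ab j).1 (ab j).2]].

End lebesgue.

Section dynamics.
Variables (R : realType) (N : nat).

(* T t y is the value at time t >= 0 of the solution of y' = X(y) issued
   from y; nothing is required for t < 0. *)
Definition is_flow (X : 'cV[R[i]]_N -> 'cV[R[i]]_N)
    (T : R -> 'cV[R[i]]_N -> 'cV[R[i]]_N) : Prop :=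
  forall y, [/\ T 0 y = y,
    forall k : 'I_N * bool,
      {within `[0, +oo[, continuous (fun t : R => rcoord k (T t y))} &
    forall k (t : R), 0 < t ->
      is_derive t 1 (fun s : R => rcoord k (T s y)) (rcoord k (X (T t y)))].

Definition invariant_measure (T : R -> 'cV[R[i]]_N -> 'cV[R[i]]_N)
    (mu : probability 'cV[R[i]]_N R) : Prop :=
  forall t S, 0 <= t -> measurable S -> mu (T t @^-1` S) = mu S.

(* The Lebesgue-negligible set of exceptional initial data may depend on the
   observable phi. *)
Definition physically_relevant (T : R -> 'cV[R[i]]_N -> 'cV[R[i]]_N)
    (mu : probability 'cV[R[i]]_N R) : Prop :=
  exists2 S : set 'cV[R[i]]_N,
    (@lebesgue_outer R N).-caratheodory S /\ (0 < lebesgue_outer S)%E &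
    forall phi : 'cV[R[i]]_N -> R, mu.-integrable setT (EFin \o phi) ->
      lebesgue_outer (S `\` [set y |
        (forall tau : R, 0 < tau ->
          lebesgue_measure.-integrable `[0, tau]
            (fun t => (phi (T t y))%:E)) /\
        (fun tau : R => tau^-1 *
           \int[lebesgue_measure]_(t in `[0, tau]) phi (T t y))
          @ +oo --> (\int[mu]_z phi z)]) = 0%E.

End dynamics.

Section splitting.
Variables (R : realType) (N : nat).
Variables (e : 'I_N -> 'cV[R[i]]_N) (m : nat).

(* Indices start at 0: e_1, ..., e_m are the e i with i < m. *)
Definition Ec : {vspace 'cV[R[i]]_N} :=
  <<[seq e i | i : 'I_N <- enum 'I_N & (i < m)%N]>>%VS.
Definition Es : {vspace 'cV[R[i]]_N} :=
  <<[seq e i | i : 'I_N <- enum 'I_N & (m <= i)%N]>>%VS.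

Definition Pic : 'cV[R[i]]_N -> subvs_of Ec := proj Ec Es.
Definition Pis : 'cV[R[i]]_N -> subvs_of Es := proj Es Ec.

HB.instance Definition _ := MeasurableFun.on Pic.
HB.instance Definition _ := MeasurableFun.on Pis.

Definition spectral_setting (A : 'M[R[i]]_N) (beta : 'I_N -> R[i]) : Prop :=
  [/\ char_poly A = \prod_i ('X - (beta i)%:P),
      forall i, exists k, (A - (beta i)%:M) ^+ k *m e i = 0,
      basis_of fullv [seq e i | i <- enum 'I_N],
      forall i j : 'I_N, (i <= j)%N ->
        complex.Re (beta j) < complex.Re (beta i) \/
        complex.Re (beta j) = complex.Re (beta i) /\
        complex.Im (beta j) <= complex.Im (beta i) &
      forall i j : 'I_N, i.+1 = m -> j = m :> nat ->
        complex.Re (beta j) < complex.Re (beta i)].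

Variable mu : probability 'cV[R[i]]_N R.

Definition mfrak : probability (subvs_of Ec) R := distribution mu Pic.

Definition is_disintegration (mu_ : R.-pker (subvs_of Ec) ~> (subvs_of Es)) :
    Prop :=
  forall U C, measurable U -> measurable C ->
    mu [set y | U (Pic y) /\ C (Pis y)] = (\int[mfrak]_(xi in U) mu_ xi C)%E.

Definition L2_space (Psi : subvs_of Ec -> subvs_of Es) : Prop :=
  measurable_fun setT Psi /\
  (\int[mfrak]_xi ((cnorm (vsval (Psi xi))) ^+ 2)%:E < +oo)%E.

Definition defect (Psi : subvs_of Ec -> subvs_of Es) : \bar R :=
  (\int[mu]_y ((cnorm (vsval (Pis y - Psi (Pic y)))) ^+ 2)%:E)%E.

Definition optimal_parameterization (Psi : subvs_of Ec -> subvs_of Es) : Prop :=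
  L2_space Psi /\ forall Phi, L2_space Phi ->
    (defect Psi <= defect Phi)%E /\
    (defect Phi = defect Psi -> {ae mfrak, forall xi, Phi xi = Psi xi}).

Variable mu_ : R.-pker (subvs_of Ec) ~> (subvs_of Es).

Definition Psi_star (xi : subvs_of Ec) : subvs_of Es :=
  vint (mu_ xi) (fun zeta => zeta).

Definition cond_expectation (X : 'cV[R[i]]_N -> 'cV[R[i]]_N)
    (xi : subvs_of Ec) : subvs_of Ec :=
  vint (mu_ xi) (fun zeta => Pic (X (vsval xi + vsval zeta))).

Definition eta_term (B : 'cV[R[i]]_N -> 'cV[R[i]]_N -> 'cV[R[i]]_N)
    (xi : subvs_of Ec) : subvs_of Ec :=
  vint (mu_ xi) (fun zeta => Pic (B (vsval zeta) (vsval zeta))).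

End splitting.

Definition vector_field (R : realType) (N : nat) (A : 'M[R[i]]_N)
    (B : 'cV[R[i]]_N -> 'cV[R[i]]_N -> 'cV[R[i]]_N) (F y : 'cV[R[i]]_N) :
    'cV[R[i]]_N :=
  A *m y + B y y + F.

(* Main.v *)
From HB Require Import structures.
Require Import Defs.
From mathcomp Require Import all_boot all_order all_algebra sesquilinear.
From mathcomp Require Import all_classical all_reals all_analysis.
From mathcomp Require Import measurable_realfun complex.
From mathcomp Require Import ring lra.

(** The theorem is conditional expectation in coordinates. Disintegrating [mu]
    over the projection onto [Ec] turns every integral against [mu] into an
    integral over the fibers, so that the second moment of [mu] along [Es] is
    the [mfrak]-integral of the second moments of the fiber measures [mu_ xi]
    ([integral_disintegration]). Hence almost every fiber measure has a finite
    second moment; there all polynomials of degree at most two in [zeta] are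
    integrable, and everything else takes place on one such fiber.

    Optimality of [Psi_star]: on a fiber, the mean is the best constant, the
    excess of any other constant [a] being the squared distance from [a] to the
    mean ([bias_variance]). Integrated over [Ec] this is the Pythagorean identity
    [defect_pythagoras]
      [defect Phi = defect Psi_star + \int |Psi_star - Phi|^2],
    which yields minimality and uniqueness, and, for [Phi = 0], the square
    integrability of [Psi_star].

    Formula for the conditional expectation: expand [X (xi + zeta)] by
    bilinearity into a part constant in [zeta], a part linear in [zeta] and
    [B zeta zeta]. Integration commutes with linear maps ([cint_linear]), so the
    linear part contributes its value at [Psi_star xi], and the quadratic part
    contributes [eta]. The only linear term absent from the result is
    [Pic (A Psi_star)]. It vanishes because [Es] is stable under [A]: the
    spectral gap makes the eigenvalues of the two blocks disjoint, so [Es] is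
    the kernel of a polynomial in [A] ([generalized_eigenspan_stable]). *)

Set Implicit Arguments.
Unset Strict Implicit.
Unset Printing Implicit Defensive.

Import Order.TTheory GRing.Theory Num.Theory.
Import numFieldNormedType.Exports.

Local Open Scope classical_set_scope.
Local Open Scope ring_scope.

(** * Stability of spans of generalized eigenvectors *)

Section spectral.
Variables (K : fieldType) (n : nat).
Implicit Types (A : 'M[K]_n.+1) (p q : {poly K}) (x y : 'cV[K]_n.+1).

Lemma horner_mx_XsubC_exp A (b : K) k :
  horner_mx A (('X - b%:P) ^+ k) = (A - b%:M) ^+ k.
Proof. by rewrite rmorphXn rmorphB /= horner_mx_X horner_mx_C. Qed.

(** Bezout: a vector killed by two coprime polynomials in [A] is killed by 1. *)
Lemma coprime_annihilators A p q x : coprimep p q ->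
  horner_mx A p *m x = 0 -> horner_mx A q *m x = 0 -> x = 0.
Proof.
move=> /Bezout_eq1_coprimepP [[u v] /= uv] px qx.
have <- : horner_mx A (u * p + v * q) *m x = x by rewrite uv rmorph1 mul1mx.
by rewrite rmorphD !rmorphM /= mulmxDl -!mulmxA px qx !mulmx0 addr0.
Qed.

Lemma coprimep_prod_exp_XsubC (I : finType) (P Q : pred I) (b : I -> K)
    (k : I -> nat) :
  (forall i j, P i -> Q j -> b i != b j) ->
  coprimep (\prod_(i | P i) ('X - (b i)%:P) ^+ k i)
           (\prod_(j | Q j) ('X - (b j)%:P) ^+ k j).
Proof.
move=> bPQ; set q := (X in coprimep _ X).
apply: (big_ind (fun p => coprimep p q)) => [|p p' hp hp'|i Pi].
- exact: coprime1p.
- by rewrite coprimepMl hp.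
rewrite {}/q; apply: (big_ind (coprimep _)) => [|p p' hp hp'|j Qj].
- exact: coprimep1.
- by rewrite coprimepMr hp.
apply/coprimep_expl/coprimep_expr/coprimep_XsubC2.
by rewrite subr_eq0 eq_sym bPQ.
Qed.

Lemma span_annihilator A (I : finType) (P : pred I) (b : I -> K)
    (k : I -> nat) (e : I -> 'cV[K]_n.+1) y :
  (forall i, (A - (b i)%:M) ^+ k i *m e i = 0) ->
  y \in <<[seq e i | i <- enum I & P i]>>%VS ->
  horner_mx A (\prod_(i | P i) ('X - (b i)%:P) ^+ k i) *m y = 0.
Proof.
set s := [seq e i | i <- _ & _] => eK ys.
rewrite (coord_span (X := in_tuple s) ys) mulmx_sumr big1// => j _.
rewrite -scalemxAr; apply/eqP; rewrite scaler_eq0; apply/orP; right.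
have /mapP[i + ->] : s`_j \in [seq e i | i <- enum I & P i].
  exact: mem_nth (ltn_ord j).
rewrite mem_filter => /andP[Pi _]; rewrite (bigD1 i)//= mulrC rmorphM /=.
by rewrite -mulmxA horner_mx_XsubC_exp eK mulmx0.
Qed.

(** Let [p] be the product of the [('X - b i) ^+ k i] with [P i]. On the span of
    the [e i] with [P i], [p] vanishes at [A]; the complementary product
    vanishes on the complementary span and is coprime to [p]. So the span is
    the whole kernel of [horner_mx A p], and [A] commutes with that matrix. *)
Lemma generalized_eigenspan_stable A (I : finType) (P : pred I) (b : I -> K)
    (e : I -> 'cV[K]_n.+1) y :
  (forall i, exists k, (A - (b i)%:M) ^+ k *m e i = 0) ->
  (forall i j, ~~ P i -> P j -> b i != b j) ->
  (<<[seq e i | i <- enum I & ~~ P i]>> + <<[seq e i | i <- enum I & P i]>>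
    = fullv)%VS ->
  y \in <<[seq e i | i <- enum I & P i]>>%VS ->
  A *m y \in <<[seq e i | i <- enum I & P i]>>%VS.
Proof.
move=> /(@choice I nat (fun i k => _ = _))[k ek] bPQ spanT yP.
set p := \prod_(i | P i) ('X - (b i)%:P) ^+ k i.
have : A *m y \in fullv by exact: memvf.
rewrite -spanT => /memv_addP[c cQ [s sP Ay]].
(* The component of [A *m y] off the span is killed by both products. *)
suff c0 : c = 0 by rewrite Ay c0 add0r.
apply: (coprime_annihilators (coprimep_prod_exp_XsubC k bPQ)).
  exact: (span_annihilator (P := predC P) ek).
have -> : c = A *m y - s by rewrite Ay addrK.
rewrite mulmxBr (span_annihilator ek sP) subr0 mulmxA.
have -> : horner_mx A p *m A = A *m horner_mx A p.
  exact: comm_horner_mx.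
by rewrite -mulmxA (span_annihilator ek yP) mulmx0.
Qed.

End spectral.

Section basis_split.
Variables (K : fieldType) (vT : vectType K) (I : finType).
Variables (e : I -> vT) (Q : pred I).
Hypothesis be : basis_of fullv [seq e i | i <- enum I].

Let perm_split : perm_eq [seq e i | i <- enum I]
  ([seq e i | i <- enum I & ~~ Q i] ++ [seq e i | i <- enum I & Q i]).
Proof. by rewrite perm_sym perm_catC -map_cat perm_map// perm_filterC. Qed.

Lemma basis_split_sum :
  (<<[seq e i | i <- enum I & ~~ Q i]>> + <<[seq e i | i <- enum I & Q i]>>
   = fullv)%VS.
Proof.
rewrite -span_cat -(span_basis be); apply: eq_span => x.
by rewrite (perm_mem perm_split).
Qed.

Lemma basis_split_cap :
  (<<[seq e i | i <- enum I & ~~ Q i]>> :&: <<[seq e i | i <- enum I & Q i]>>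
   = 0)%VS.
Proof.
have := basis_free be; rewrite (perm_free perm_split) cat_free.
by case/and3P => _ _ /directv_addP.
Qed.

End basis_split.

Section spectral_splitting.
Variables (R : realType) (N m : nat) (A : 'M[R[i]]_N) (beta : 'I_N -> R[i]).
Variable e : 'I_N -> 'cV[R[i]]_N.
Hypotheses (mN : (1 <= m < N)%N) (sA : spectral_setting e m A beta).

Let EcE :
  Ec e m = <<[seq e i | i : 'I_N <- enum 'I_N & ~~ (m <= i)%N]>>%VS.
Proof. by rewrite /Ec; under eq_filter do rewrite ltnNge. Qed.

Lemma Ec_cap_Es : (Ec e m :&: Es e m = 0)%VS.
Proof. by rewrite EcE; case: sA => _ _ be _ _; exact: basis_split_cap. Qed.

Lemma Ec_add_Es : (Ec e m + Es e m = fullv)%VS.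
Proof. by rewrite EcE; case: sA => _ _ be _ _; exact: basis_split_sum. Qed.

(** Real parts decrease with the index and drop strictly between the last index
    below [m] and [m] itself. *)
Lemma spectral_gap (i j : 'I_N) : (i < m)%N -> (m <= j)%N -> beta i != beta j.
Proof.
case/andP: mN => m0 ltmN im mj; case: sA => _ _ _ ord gap.
have le_Re (i' j' : 'I_N) :
    (i' <= j')%N -> complex.Re (beta j') <= complex.Re (beta i').
  by move=> /ord[/ltW|[->]].
have pm : (m.-1 < N)%N by rewrite (leq_ltn_trans (leq_pred m)).
have := gap (Ordinal pm) (Ordinal ltmN) (prednK m0) erefl.
have := le_Re i (Ordinal pm); rewrite /= -ltnS prednK// => /(_ im) le1.
have := le_Re (Ordinal ltmN) j mj => le2 lt1.
apply/eqP => /(congr1 (@complex.Re R)) Eij.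
by move: (lt_le_trans (le_lt_trans le2 lt1) le1); rewrite Eij ltxx.
Qed.

Lemma Es_stable y : y \in Es e m -> A *m y \in Es e m.
Proof.
have gapN (i j : 'I_N) : ~~ (m <= i)%N -> (m <= j)%N -> beta i != beta j.
  by rewrite -ltnNge; exact: spectral_gap.
case: sA => _ gen be _ _.
(* [horner_mx] asks for matrices of positive size. *)
clear sA mN; case: N A beta e gen be gapN y => [|n] A' beta' e' gen be gapN y.
  by rewrite (_ : A' *m y = 0) ?mem0v//; apply/matrixP => -[].
apply: (generalized_eigenspan_stable gen gapN).
exact: basis_split_sum.
Qed.

End spectral_splitting.

(** * Real coordinates on C^N *)

Section real_coordinates.
Local Open Scope complex_scope.
Variables (R : realType) (N : nat).
Implicit Types (x y z : 'cV[R[i]]_N) (k : 'I_N * bool).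

Lemma rcoord_ext x y : (forall k, rcoord k x = rcoord k y) -> x = y.
Proof.
move=> xy; apply/colP => i; move: (xy (i, false)) (xy (i, true)).
by rewrite /rcoord /=; case: (x i 0) (y i 0) => [a b] [c d] /= -> ->.
Qed.

Lemma rcoordD k x y : rcoord k (x + y) = rcoord k x + rcoord k y.
Proof.
by rewrite /rcoord mxE; case: (x _ _) (y _ _) => [? ?] [? ?]; case: ifP.
Qed.

Lemma rcoordN k x : rcoord k (- x) = - rcoord k x.
Proof. by rewrite /rcoord mxE; case: (x _ _) => ? ?; case: ifP. Qed.

Lemma rcoordB k x y : rcoord k (x - y) = rcoord k x - rcoord k y.
Proof. by rewrite rcoordD rcoordN. Qed.

Lemma rcoord0 k : rcoord k 0 = 0 :> R.
Proof. by rewrite /rcoord mxE /=; case: ifP. Qed.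

Lemma rcoord_sum k (I : Type) (s : seq I) (P : pred I) (F : I -> 'cV[R[i]]_N) :
  rcoord k (\sum_(j <- s | P j) F j) = \sum_(j <- s | P j) rcoord k (F j).
Proof. exact: (big_morph _ (rcoordD k) (rcoord0 k)). Qed.

Lemma rcoordZ k (a : R) x : rcoord k (a%:C *: x) = a * rcoord k x.
Proof.
rewrite /rcoord mxE; case: (x _ _) => b c /=; case: ifP => _ /=.
  by rewrite mul0r addr0.
by rewrite mul0r subr0.
Qed.

(** The basis of C^N over R dual to [rcoord]. In it, linear and bilinear maps
    have coordinates that are polynomials with real coefficients in the real
    coordinates of their arguments; this reduces their integrals to real ones. *)
Definition real_basis k : 'cV[R[i]]_N :=
  (if k.2 then 'i else 1) *: delta_mx k.1 0.

Lemma real_basis_expansion y :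
  y = \sum_k (rcoord k y)%:C *: real_basis k.
Proof.
rewrite -(pair_bigA _
  (fun i b => (rcoord (i, b) y)%:C *: real_basis (i, b))) /=.
rewrite {1}[y]matrix_sum_delta; apply: eq_bigr => i _.
rewrite big_ord1 big_bool /real_basis /rcoord /= !scalerA -scalerDl mulr1.
congr (_ *: _); case: (y i 0) => a b; simpc.
by congr (_ +i* _); ring.
Qed.

Lemma rcoord_linear (f : {linear 'cV[R[i]]_N -> 'cV[R[i]]_N}) k y :
  rcoord k (f y) = \sum_j rcoord j y * rcoord k (f (real_basis j)).
Proof.
rewrite {1}[y]real_basis_expansion linear_sum rcoord_sum.
by apply: eq_bigr => j _; rewrite linearZ rcoordZ.
Qed.

Lemma rcoord_bilinear
    (B : {bilinear 'cV[R[i]]_N -> 'cV[R[i]]_N -> 'cV[R[i]]_N}) k y z :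
  rcoord k (B y z) = \sum_j \sum_l
    rcoord j y * rcoord l z * rcoord k (B (real_basis j) (real_basis l)).
Proof.
rewrite {1}[y]real_basis_expansion linear_sumlz rcoord_sum.
apply: eq_bigr => j _; rewrite linearZl_LR rcoordZ rcoord_linear mulr_sumr.
by apply: eq_bigr => l _; rewrite mulrA.
Qed.

Lemma sqr_cnorm y : cnorm y ^+ 2 = \sum_k rcoord k y ^+ 2.
Proof. by rewrite sqr_sqrtr// sumr_ge0// => k _; exact: sqr_ge0. Qed.

Lemma rcoord_le_sqr_cnorm k y : rcoord k y ^+ 2 <= cnorm y ^+ 2.
Proof.
rewrite sqr_cnorm (bigD1 k)//= lerDl sumr_ge0// => j _.
exact: sqr_ge0.
Qed.

Lemma sqr_cnorm_eq0 y : cnorm y ^+ 2 = 0 -> y = 0.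
Proof.
move=> y0; apply: rcoord_ext => k; rewrite rcoord0; apply/eqP.
by rewrite -sqrf_eq0 eq_le sqr_ge0 -y0 rcoord_le_sqr_cnorm.
Qed.

End real_coordinates.

Section measurability.
Variables (R : realType) (N : nat).

Lemma measurable_sqr_cnorm :
  measurable_fun setT (fun y : 'cV[R[i]]_N => cnorm y ^+ 2).
Proof.
under eq_fun do rewrite sqr_cnorm.
apply: measurable_sum => k; apply: measurable_funX.
exact: measurable_rcoord.
Qed.

Lemma measurable_cvecB d (T : measurableType d) (f g : T -> 'cV[R[i]]_N) :
  measurable_fun setT f -> measurable_fun setT g ->
  measurable_fun setT (fun x => f x - g x).
Proof.
move=> mf mg; apply: measurable_cvecP => k; under eq_fun do rewrite rcoordB.
by apply: measurable_funB; apply: measurableT_comp => //;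
  exact: measurable_rcoord.
Qed.

Variable V : {vspace 'cV[R[i]]_N}.

Lemma measurable_vsval : measurable_fun setT (vsval : subvs_of V -> _).
Proof. by move=> _ A mA; exists A. Qed.

Lemma measurable_subvsP d (T : measurableType d) (f : T -> subvs_of V) :
  measurable_fun setT (vsval \o f) -> measurable_fun setT f.
Proof. by move=> mf _ _ [A mA <-]; rewrite setTI -comp_preimage; exact: mf. Qed.

Lemma measurable_vsproj : measurable_fun setT (vsproj V).
Proof.
apply: measurable_subvsP.
exact: (@measurable_linear R N (vsval \o vsproj V)).
Qed.

End measurability.

(** * Componentwise integrals *)

Section vector_integral.
Context d (T : measurableType d) (R : realType) (N : nat).
Variable P : probability T R.
Implicit Types f g : T -> 'cV[R[i]]_N.

Definition cintegrable f : Prop :=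
  forall k, P.-integrable setT (fun x => (rcoord k (f x))%:E).

Lemma rcoord_cint k f : rcoord k (cint P f) = \int[P]_x rcoord k (f x).
Proof. by case: k => i []; rewrite /rcoord /cint !mxE. Qed.

Lemma integrable_real_sum (I : Type) (s : seq I) (F : I -> T -> R) :
  (forall j, P.-integrable setT (fun x => (F j x)%:E)) ->
  P.-integrable setT (fun x => (\sum_(j <- s) F j x)%:E) /\
  \int[P]_x (\sum_(j <- s) F j x) = \sum_(j <- s) \int[P]_x F j x.
Proof.
move=> iF; elim: s => [|j s [is_ IHs]].
  under eq_fun do rewrite big_nil; rewrite big_nil; split.
    exact: integrable0.
  by under eq_Rintegral do rewrite big_nil; rewrite Rintegral_cst// mul0r.
split.
  under eq_fun do rewrite big_cons EFinD.
  exact: integrableD.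
under eq_Rintegral do rewrite big_cons.
by rewrite RintegralD//; [rewrite big_cons -IHs | exact: iF].
Qed.

Lemma cintegrable_linear (L : {linear 'cV[R[i]]_N -> 'cV[R[i]]_N}) f :
  cintegrable f -> cintegrable (L \o f).
Proof.
move=> fi k /=; under eq_fun do rewrite rcoord_linear.
apply: (proj1 (integrable_real_sum _ _)) => j.
by under eq_fun do rewrite EFinM; exact: integrableZr.
Qed.

Lemma cint_linear (L : {linear 'cV[R[i]]_N -> 'cV[R[i]]_N}) f :
  cintegrable f -> cint P (L \o f) = L (cint P f).
Proof.
move=> fi; apply: rcoord_ext => k; rewrite rcoord_cint rcoord_linear /=.
under eq_Rintegral do rewrite rcoord_linear.
rewrite (proj2 (integrable_real_sum _ _)) => [|j].
  by apply: eq_bigr => j _; rewrite RintegralZr ?rcoord_cint//; exact: fi.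
by under eq_fun do rewrite EFinM; exact: integrableZr.
Qed.

Lemma cintegrableD f g :
  cintegrable f -> cintegrable g -> cintegrable (fun x => f x + g x).
Proof.
move=> fi gi k; under eq_fun do rewrite rcoordD EFinD.
exact: integrableD.
Qed.

Lemma cintD f g : cintegrable f -> cintegrable g ->
  cint P (fun x => f x + g x) = cint P f + cint P g.
Proof.
move=> fi gi; apply: rcoord_ext => k; rewrite rcoordD !rcoord_cint.
under eq_Rintegral do rewrite rcoordD.
by rewrite RintegralD//; [exact: fi | exact: gi].
Qed.

Lemma cintegrable_cst (c : 'cV[R[i]]_N) : cintegrable (fun=> c).
Proof. by move=> k; apply/finite_measure_integrable_cst. Qed.

Lemma cint_cst (c : 'cV[R[i]]_N) : cint P (fun=> c) = c.
Proof.
apply: rcoord_ext => k; rewrite rcoord_cint Rintegral_cst//.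
by rewrite [X in fine X](probability_setT P) mulr1.
Qed.

Variable V : {vspace 'cV[R[i]]_N}.

Lemma vint_linear (L : {linear 'cV[R[i]]_N -> subvs_of V}) f :
  cintegrable f -> vint P (L \o f) = L (cint P f).
Proof.
move=> fi; rewrite /vint -[RHS]vsvalK.
by congr vsproj; exact: (cint_linear (vsval \o L) fi).
Qed.

(** [vsproj V] is a linear map that is the identity on the values of [f], so it
    fixes their integral. *)
Lemma vintK (f : T -> subvs_of V) :
  vintegrable P f -> vsval (vint P f) = cint P (vsval \o f).
Proof.
move=> fi; rewrite /vint -[LHS]/((vsval \o vsproj V) _).
rewrite -(cint_linear (vsval \o vsproj V) (f := vsval \o f))//.
by congr cint; apply/funext => x /=; rewrite vsvalK.
Qed.

End vector_integral.

(** * Square integrable vector-valued functions *)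

Section square_integrable.
Context d (T : measurableType d) (R : realType) (N : nat).
Variables (P : probability T R) (f : T -> 'cV[R[i]]_N).
Hypothesis mf : measurable_fun setT f.
Hypothesis f2 : (\int[P]_x (cnorm (f x) ^+ 2)%:E < +oo)%E.

Let mfk k : measurable_fun setT (fun x => rcoord k (f x)).
Proof. by apply: measurableT_comp => //; exact: measurable_rcoord. Qed.

Let integrable_sqr_cnorm :
  P.-integrable setT (fun x => (cnorm (f x) ^+ 2)%:E).
Proof.
apply/integrableP; split.
  apply/measurable_EFinP.
  exact: (measurableT_comp (@measurable_sqr_cnorm R N) mf).
by under eq_integral do rewrite gee0_abs ?lee_fin ?sqr_ge0//.
Qed.

(** Each product of two coordinates is dominated by the squared norm, as
    [2 * |a| * |b| <= a ^+ 2 + b ^+ 2]. *)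
Lemma integrable_rcoordM j k :
  P.-integrable setT (fun x => (rcoord j (f x) * rcoord k (f x))%:E).
Proof.
apply: (le_integrable measurableT _ _ integrable_sqr_cnorm) => //.
  by apply/measurable_EFinP; exact: measurable_funM.
move=> x _; rewrite !abse_EFin lee_fin normrM [leRHS]ger0_norm ?sqr_ge0//.
have := rcoord_le_sqr_cnorm j (f x); have := rcoord_le_sqr_cnorm k (f x).
rewrite -(real_normK (num_real (rcoord j _))).
rewrite -(real_normK (num_real (rcoord k _))).
have := sqr_ge0 (`|rcoord j (f x)| - `|rcoord k (f x)|); nra.
Qed.

(** On a probability space square integrability implies integrability, since
    [|a| <= 1 + a ^+ 2]. *)
Lemma cintegrable_sqr : cintegrable P f.
Proof.
move=> k.
have i1 : P.-integrable setT (cst 1%:E : T -> \bar R).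
  exact: finite_measure_integrable_cst.
apply: (le_integrable measurableT _ _
  (integrableD measurableT i1 (integrable_rcoordM k k))) => //.
  exact/measurable_EFinP.
move=> x _ /=; rewrite lee_fin [leRHS]ger0_norm; last first.
  by rewrite addr_ge0// -expr2 sqr_ge0.
rewrite -expr2 -(real_normK (num_real (rcoord k _))).
have := sqr_ge0 (`|rcoord k (f x)| - 1).
have := normr_ge0 (rcoord k (f x)); nra.
Qed.

Lemma cintegrable_bilinear_sqr
    (B : {bilinear 'cV[R[i]]_N -> 'cV[R[i]]_N -> 'cV[R[i]]_N}) :
  cintegrable P (fun x => B (f x) (f x)).
Proof.
move=> k; under eq_fun do rewrite rcoord_bilinear.
apply: (proj1 (integrable_real_sum _ _)) => j.
apply: (proj1 (integrable_real_sum _ _)) => l.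
by under eq_fun do rewrite EFinM; apply: integrableZr => //;
  exact: integrable_rcoordM.
Qed.

Lemma integral_sqr_rcoordB k (c : R) :
  (\int[P]_x ((rcoord k (f x) - c) ^+ 2)%:E =
   (\int[P]_x (rcoord k (f x) ^+ 2)
    - 2 * c * rcoord k (cint P f) + c ^+ 2)%:E)%E.
Proof.
have i2 : P.-integrable setT (EFin \o (fun x => rcoord k (f x) ^+ 2)).
  exact: integrable_rcoordM.
have i1 : P.-integrable setT (EFin \o (fun x => - (2 * c) * rcoord k (f x))).
  rewrite /comp; under eq_fun do rewrite EFinM.
  by apply: integrableZl => //; exact: cintegrable_sqr.
have i0 : P.-integrable setT (EFin \o (fun=> c ^+ 2)).
  exact: finite_measure_integrable_cst.
have i10 : P.-integrable setT
    (EFin \o (fun x => - (2 * c) * rcoord k (f x) + c ^+ 2)).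
  exact: integrableD _ i1 i0.
under eq_integral => x _.
  rewrite (_ : _ ^+ 2 = rcoord k (f x) ^+ 2 +
    (- (2 * c) * rcoord k (f x) + c ^+ 2)); last by ring.
  over.
rewrite -[LHS]fineK; last exact: integrable_fin_num (integrableD _ i2 i10).
congr EFin; transitivity (\int[P]_x
  (rcoord k (f x) ^+ 2 + (- (2 * c) * rcoord k (f x) + c ^+ 2))) => //.
rewrite RintegralD// RintegralD// RintegralZl//; last exact: cintegrable_sqr.
rewrite Rintegral_cst// [X in fine X](probability_setT P) rcoord_cint /= mulr1.
ring.
Qed.

(** In each coordinate both sides are second-degree polynomials in [a] with the
    same coefficients, by [integral_sqr_rcoordB]. *)
Lemma bias_variance (a : 'cV[R[i]]_N) :
  (\int[P]_x (cnorm (f x - a) ^+ 2)%:E =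
   \int[P]_x (cnorm (f x - cint P f) ^+ 2)%:E +
   (cnorm (cint P f - a) ^+ 2)%:E)%E.
Proof.
have sqrE (b : 'cV[R[i]]_N) : (\int[P]_x (cnorm (f x - b) ^+ 2)%:E =
    \sum_k \int[P]_x ((rcoord k (f x) - rcoord k b) ^+ 2)%:E)%E.
  rewrite -ge0_integral_sum//.
  - apply: eq_integral => x _; rewrite sqr_cnorm -sumEFin.
    by apply: eq_bigr => k _; rewrite rcoordB.
  - by move=> k; apply/measurable_EFinP/measurable_funX/measurable_funB.
  - by move=> k x _; rewrite lee_fin sqr_ge0.
rewrite !sqrE sqr_cnorm -sumEFin -big_split /=.
apply: eq_bigr => k _; rewrite !integral_sqr_rcoordB -EFinD rcoordB.
by congr EFin; ring.
Qed.

End square_integrable.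

(** * Probability kernels and disintegration *)

Section kernel_integral.
Context d1 d2 (X : measurableType d1) (Y : measurableType d2) (R : realType).
Variable k : R.-pker X ~> Y.

Lemma measurable_kernel_Rintegral (g : Y -> R) : measurable_fun setT g ->
  measurable_fun setT (fun x => \int[k x]_y g y).
Proof.
move=> mg; apply: measurableT_comp => //.
under eq_fun do rewrite integralE.
apply: emeasurable_funB; apply: measurable_fun_integral_kernel => //.
- by move=> U mU; exact: measurable_kernel.
- by apply: measurable_funepos; exact/measurable_EFinP.
- by move=> U mU; exact: measurable_kernel.
- by apply: measurable_funeneg; exact/measurable_EFinP.
Qed.

(** Also where [g] is not integrable, each coordinate of [vint] is computed from
    differences of two integrals that are measurable in [x]. *)
Lemma measurable_kernel_vint (N : nat) (V : {vspace 'cV[R[i]]_N})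
    (g : Y -> subvs_of V) : measurable_fun setT g ->
  measurable_fun setT (fun x => vint (k x) g).
Proof.
move=> mg; apply: measurableT_comp; first exact: measurable_vsproj.
apply: measurable_cvecP => -[i b].
rewrite (_ : (fun x => _) =
    fun x => \int[k x]_y rcoord (i, b) (vsval (g y))); last first.
  by apply/funext => x; rewrite /rcoord /cint !mxE; case: b.
apply: measurable_kernel_Rintegral; apply: measurableT_comp.
  exact: measurable_rcoord.
by apply: measurableT_comp => //; exact: measurable_vsval.
Qed.

End kernel_integral.

Section kernel_probability.
Context d1 d2 (X : measurableType d1) (Y : measurableType d2) (R : realType).
Variables (k : R.-pker X ~> Y) (x : X).

(** [k x] is canonically a measure only; this copy is also a probability, to
    which the results on square integrable functions apply. *)
Definition kernel_probability : set Y -> \bar R := k x.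

HB.instance Definition _ := Measure.on kernel_probability.

HB.instance Definition _ :=
  Measure_isProbability.Build _ _ _ kernel_probability (prob_kernel x).

End kernel_probability.

Section fiber_kernel.
Context d1 d2 (X : measurableType d1) (Y : measurableType d2) (R : realType).
Variable k : R.-pker X ~> Y.

(** The measure [k x], carried to the fiber of [X * Y] above [x]. The dummy [unit]
    component puts [fiber_kernel] in the form required of the second factor of
    a composition of kernels, whose first factor is a measure seen as a kernel
    with source [unit]. *)
Definition fiber_measure (ux : unit * X) : set (X * Y) -> \bar R :=
  pushforward (k ux.2) (pair ux.2).

Section fiber_measure_is_measure.
Variable ux : unit * X.

Let mpair : measurable_fun [set: Y] (pair ux.2).
Proof. exact: measurable_pair1. Qed.

Let fiber0 : fiber_measure ux set0 = 0%E.
Proof. exact: measure0. Qed.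

Let fiber_ge0 A : (0 <= fiber_measure ux A)%E.
Proof. exact: measure_ge0. Qed.

Let fiber_sigma_additive : semi_sigma_additive (fiber_measure ux).
Proof. exact: measure_semi_sigma_additive. Qed.

HB.instance Definition _ := isMeasure.Build _ _ _ (fiber_measure ux)
  fiber0 fiber_ge0 fiber_sigma_additive.

End fiber_measure_is_measure.

Definition fiber_kernel (ux : unit * X) : {measure set (X * Y) -> \bar R} :=
  fiber_measure ux.

Let fiber_kernelE ux A : fiber_kernel ux A = k ux.2 (xsection A ux.2).
Proof. by rewrite /fiber_kernel /= /fiber_measure /pushforward xsectionE. Qed.

Let measurable_fiber_kernel U :
  measurable U -> measurable_fun setT (fiber_kernel ^~ U).
Proof.
move=> mU; rewrite (_ : fiber_kernel ^~ U =
  (fun x => k x (xsection U x)) \o snd); last first.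
  by apply/funext => ux; rewrite fiber_kernelE.
apply: measurableT_comp => //.
by apply: measurable_fun_xsection_finite_kernel; rewrite inE.
Qed.

HB.instance Definition _ :=
  isKernel.Build _ _ _ _ _ fiber_kernel measurable_fiber_kernel.

Let fiber_kernelT ux : fiber_kernel ux setT = 1%E.
Proof. by rewrite fiber_kernelE xsectionE preimage_setT prob_kernel. Qed.

HB.instance Definition _ :=
  Kernel_isProbability.Build _ _ _ _ _ fiber_kernel fiber_kernelT.

End fiber_kernel.

Section disintegration.
Context d d1 d2 (T : measurableType d) (X : measurableType d1)
  (Y : measurableType d2) (R : realType).
Variables (P : probability T R) (p : {mfun T >-> X}) (q : {mfun T >-> Y})
  (k : R.-pker X ~> Y).
Hypothesis Pk : forall U C, measurable U -> measurable C ->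
  P [set t | U (p t) /\ C (q t)] = (\int[distribution P p]_(x in U) k x C)%E.

Let law_p : unit -> pprobability X R :=
  fun=> (distribution P p : probability X R).

(** The composition of the law of [p] with [fiber_kernel k] is a measure on
    [X * Y] that agrees with the law of [(p, q)] on rectangles, hence
    everywhere. *)
Lemma integral_disintegration (f : X * Y -> \bar R) :
  (forall z, 0 <= f z)%E -> measurable_fun setT f ->
  (\int[P]_t f (p t, q t) =
   \int[distribution P p]_x \int[k x]_y f (x, y))%E.
Proof.
move=> f0 mf.
have mpq : measurable_fun setT (fun t => (p t, q t)).
  by apply: measurable_fun_pair.
pose mpq_mixin := isMeasurableFun.Build _ _ _ _ _ mpq.
pose pq : {mfun T >-> (X * Y)%type} :=
  HB.pack (fun t => (p t, q t)) mpq_mixin.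
pose l := kprobability (measurable_cst (law_p tt) : measurable_fun _ law_p).
transitivity (\int[(l \; fiber_kernel k)%E tt]_z f z)%E; last first.
  rewrite integral_kcomp//=; apply: eq_integral => x _.
  by rewrite ge0_integral_pushforward//; exact: measurable_pair1.
transitivity (\int[distribution P pq]_z f z)%E.
  by rewrite ge0_integral_distribution.
apply: eq_measure_integral => A mA _.
pose G := [set A `*` B | A in @measurable _ X & B in @measurable _ Y].
apply: (@measure_unique _ R _ G (fun=> setT)) => //.
- exact: measurable_prod_measurableType.
- move=> _ _ [A1 mA1 [B1 mB1 <-]] [A2 mA2 [B2 mB2 <-]].
  exists (A1 `&` A2); first exact: measurableI.
  by exists (B1 `&` B2); [exact: measurableI | rewrite setXI].
- by move=> _; exists setT => //; exists setT => //; rewrite setXTT.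
- by rewrite bigcup_const//; exists 0%N.
- move=> _ [U mU [C mC <-]]; rewrite /= /kcomp /= /distribution /pushforward /=.
  rewrite [LHS](Pk mU mC) [LHS]integral_mkcond; apply: eq_integral => x _ /=.
  rewrite -[RHS]/(fiber_measure k (tt, x) (U `*` C)) /fiber_measure /pushforward.
  rewrite -xsectionE /= patchE; case: ifPn => xU.
    by rewrite in_xsectionX.
  by rewrite notin_xsectionX// measure0.
- move=> _; apply: (le_lt_trans (probability_le1 P _)); last exact: ltry.
  exact: (measurable_funPTI pq).
Qed.

End disintegration.

(** * The quadratic vector field on one fiber *)

Section projection.
Variables (R : realType) (N : nat) (U W : {vspace 'cV[R[i]]_N}).

Let proj_is_linear : linear (Defs.proj U W).
Proof. by move=> c x y; rewrite /Defs.proj !linearP. Qed.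

HB.instance Definition _ :=
  GRing.isLinear.Build _ _ _ _ (Defs.proj U W) proj_is_linear.

Lemma proj_complement0 y : (U :&: W = 0)%VS -> (U + W = fullv)%VS ->
  y \in W -> Defs.proj U W y = 0.
Proof.
move=> UW0 UWT yW; rewrite /Defs.proj.
have -> : daddv_pi U W y = 0; last exact: linear0.
have := daddv_pi_add (w := y) UW0; rewrite UWT memvf => /(_ isT).
rewrite (daddv_pi_id _ yW); last by rewrite capvC.
by move/(canRL (addrK _)); rewrite subrr.
Qed.

Variables (P : probability (subvs_of W) R) (A : 'M[R[i]]_N)
  (B : {bilinear 'cV[R[i]]_N -> 'cV[R[i]]_N -> 'cV[R[i]]_N})
  (F : 'cV[R[i]]_N).
Hypothesis P2 : (\int[P]_zeta (cnorm (vsval zeta) ^+ 2)%:E < +oo)%E.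

Local Notation X := (vector_field A B F).
Local Notation mean := (cint P (fun zeta => vsval zeta)).

Let cP : cintegrable P (fun zeta => vsval zeta).
Proof. exact: (cintegrable_sqr (@measurable_vsval _ _ _) P2). Qed.

Let cBP : cintegrable P (fun zeta => B (vsval zeta) (vsval zeta)).
Proof. exact: (cintegrable_bilinear_sqr (@measurable_vsval _ _ _) P2). Qed.

(* The summands constant, linear and quadratic in [z]. [applyr B x z] is
   [B z x], in a form that is canonically linear in [z]. *)
Let vector_fieldD x z : X (x + z) =
  (A *m x + B x x + F) + (((A *m z) + (B x z + applyr B x z)) + B z z).
Proof.
rewrite /vector_field mulmxDr linearDl !linearDr /applyr /=.
by rewrite !addrA [LHS](ACl (1*3*7*2*4*5*6)%AC).
Qed.

Hypotheses (UW0 : (U :&: W = 0)%VS) (UWT : (U + W = fullv)%VS).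
Hypothesis AW : forall y, y \in W -> A *m y \in W.

Lemma cintegrable_vector_field x :
  cintegrable P (fun zeta => X (x + vsval zeta)).
Proof.
rewrite (funext (fun zeta : subvs_of W => vector_fieldD x (vsval zeta))).
apply: cintegrableD; first exact: cintegrable_cst.
apply: cintegrableD => //; apply: cintegrableD.
  exact: (cintegrable_linear (mulmx A) cP).
apply: cintegrableD; first exact: (cintegrable_linear (B x) cP).
exact: (cintegrable_linear (applyr B x) cP).
Qed.

Lemma cint_vector_field x : cint P (fun zeta => X (x + vsval zeta)) =
  (A *m x + B x x + F) + (((A *m mean) + (B x mean + B mean x)) +
    cint P (fun zeta => B (vsval zeta) (vsval zeta))).
Proof.
rewrite (funext (fun zeta : subvs_of W => vector_fieldD x (vsval zeta))).
have iA := cintegrable_linear (mulmx A) cP.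
have iBl := cintegrable_linear (B x) cP.
have iBr := cintegrable_linear (applyr B x) cP.
have iBB := cintegrableD iBl iBr.
have iL := cintegrableD iA iBB.
rewrite cintD ?cint_cst; [|exact: cintegrable_cst|exact: cintegrableD].
rewrite cintD// cintD// cintD//; congr (_ + (_ + (_ + _) + _)).
- exact: cint_linear.
- exact: cint_linear.
- exact: (cint_linear (applyr B x) cP).
Qed.

(** The linear term [A *m mean] disappears under the projection because [W] is
    stable under [A]. *)
Lemma vint_proj_vector_field x :
  vint P (fun zeta => Defs.proj U W (X (x + vsval zeta))) =
  Defs.proj U W (A *m x) + Defs.proj U W (B x x)
  + Defs.proj U W (B x (vsval (vint P id)) + B (vsval (vint P id)) x)
  + Defs.proj U W F
  + vint P (fun zeta => Defs.proj U W (B (vsval zeta) (vsval zeta))).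
Proof.
rewrite (vint_linear (Defs.proj U W) (cintegrable_vector_field x)).
rewrite (vint_linear (Defs.proj U W) cBP) cint_vector_field.
have -> : mean = vsval (vint P id) by rewrite vintK.
rewrite !linearD /= (proj_complement0 UW0 UWT (AW (subvsP _))) add0r.
by rewrite !addrA [LHS](ACl (1*2*4*5*3*6)%AC).
Qed.

End projection.

(** * The optimal parameterization *)

Section optimality.
Variables (R : realType) (N m : nat) (e : 'I_N -> 'cV[R[i]]_N).
Variables (mu : probability 'cV[R[i]]_N R)
  (mu_ : R.-pker (subvs_of (Ec e m)) ~> (subvs_of (Es e m))).
Hypothesis dis : is_disintegration mu mu_.
Hypothesis mu2 : (\int[mu]_y (cnorm (vsval (Pis e m y)) ^+ 2)%:E < +oo)%E.

Local Notation P := (kernel_probability mu_).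

Let sq_dist (Phi : subvs_of (Ec e m) -> subvs_of (Es e m))
    (z : subvs_of (Ec e m) * subvs_of (Es e m)) : \bar R :=
  (cnorm (vsval z.2 - vsval (Phi z.1)) ^+ 2)%:E.

Let sq_dist_ge0 Phi z : (0 <= sq_dist Phi z)%E.
Proof. by rewrite lee_fin sqr_ge0. Qed.

Let measurable_sq_dist Phi :
  measurable_fun setT Phi -> measurable_fun setT (sq_dist Phi).
Proof.
move=> mPhi; apply/measurable_EFinP.
apply: (measurableT_comp (@measurable_sqr_cnorm R N)).
apply: measurable_cvecB.
  exact: measurableT_comp (@measurable_vsval _ _ _) measurable_snd.
apply: measurableT_comp (@measurable_vsval _ _ _) _.
exact: measurableT_comp mPhi measurable_fst.
Qed.

Let fiber_defect Phi xi := (\int[P xi]_zeta sq_dist Phi (xi, zeta))%E.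

Let measurable_fiber_defect Phi :
  measurable_fun setT Phi -> measurable_fun setT (fiber_defect Phi).
Proof.
move=> mPhi.
exact: (measurable_fun_integral_finite_kernel _ mu_ (sq_dist_ge0 Phi)
  (measurable_sq_dist mPhi)).
Qed.

Let defect_fiber Phi : measurable_fun setT Phi ->
  defect mu Phi = (\int[mfrak e m mu]_xi fiber_defect Phi xi)%E.
Proof.
move=> mPhi; rewrite /fiber_defect /mfrak.
rewrite -(integral_disintegration dis (sq_dist_ge0 Phi)
  (measurable_sq_dist mPhi)).
exact: eq_integral.
Qed.

Let defect0_lty : (defect mu (fun=> 0%R : subvs_of (Es e m)) < +oo)%E.
Proof.
rewrite /defect; under eq_integral do rewrite subr0.
exact: mu2.
Qed.

(** The [mfrak]-integral of the fiber second moments is the second moment of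
    [mu] along [Es], which is finite. *)
Lemma ae_fiber_sqr_integrable : {ae mfrak e m mu, forall xi,
  (\int[P xi]_zeta (cnorm (vsval zeta) ^+ 2)%:E < +oo)%E}.
Proof.
pose Phi0 : subvs_of (Ec e m) -> subvs_of (Es e m) := fun=> 0.
have mPhi0 : measurable_fun setT Phi0 by exact: measurable_cst.
have fi : (mfrak e m mu).-integrable setT (fiber_defect Phi0).
  apply/integrableP; split; first exact: measurable_fiber_defect.
  under eq_integral do rewrite gee0_abs ?integral_ge0//.
  by rewrite -defect_fiber.
have := integrable_ae measurableT fi; apply: filterS => xi /(_ I).
have sq0 zeta : sq_dist Phi0 (xi, zeta) = (cnorm (vsval zeta) ^+ 2)%:E.
  by congr ((cnorm _ ^+ 2)%:E); exact: subr0.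
rewrite /fiber_defect; under eq_integral do rewrite sq0.
by move=> /fin_numPlt/andP[].
Qed.

Lemma measurable_Psi_star : measurable_fun setT (Psi_star mu_).
Proof. exact: (measurable_kernel_vint mu_ (g := id)). Qed.

Lemma measurable_sqr_cnormB (Phi Psi : subvs_of (Ec e m) -> subvs_of (Es e m)) :
  measurable_fun setT Phi -> measurable_fun setT Psi ->
  measurable_fun setT
    (fun xi => (cnorm (vsval (Phi xi) - vsval (Psi xi)) ^+ 2)%:E).
Proof.
move=> mPhi mPsi; apply/measurable_EFinP.
apply: (measurableT_comp (@measurable_sqr_cnorm R N)).
by apply: measurable_cvecB; apply: measurableT_comp (@measurable_vsval _ _ _) _.
Qed.

(** The integral over [Ec] of [bias_variance] on the fibers. *)
Lemma defect_pythagoras Phi : measurable_fun setT Phi ->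
  (defect mu Phi = defect mu (Psi_star mu_) +
   \int[mfrak e m mu]_xi
     (cnorm (vsval (Psi_star mu_ xi) - vsval (Phi xi)) ^+ 2)%:E)%E.
Proof.
move=> mPhi; have mPsi := measurable_Psi_star.
rewrite !defect_fiber// -ge0_integralD//; last 4 first.
- by move=> xi _; exact: integral_ge0.
- exact: measurable_fiber_defect.
- by move=> xi _; rewrite lee_fin sqr_ge0.
- exact: measurable_sqr_cnormB.
apply: ge0_ae_eq_integral => //.
- exact: measurable_fiber_defect.
- apply: emeasurable_funD; first exact: measurable_fiber_defect.
  exact: measurable_sqr_cnormB.
- by move=> xi _; exact: integral_ge0.
- by move=> xi _; rewrite adde_ge0 ?integral_ge0 ?lee_fin ?sqr_ge0.
apply: filterS ae_fiber_sqr_integrable => xi xi2 _.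
have mv := @measurable_vsval R N (Es e m).
have Psi_mean : vsval (Psi_star mu_ xi) = cint (P xi) (fun zeta => vsval zeta).
  exact: (vintK (f := id) (cintegrable_sqr mv xi2)).
by rewrite /fiber_defect /sq_dist /= Psi_mean (bias_variance mv xi2).
Qed.

Lemma defect_Psi_star_lty : (defect mu (Psi_star mu_) < +oo)%E.
Proof.
apply: le_lt_trans defect0_lty; rewrite [leRHS]defect_pythagoras//.
by rewrite leeDl//; apply: integral_ge0 => xi _; rewrite lee_fin sqr_ge0.
Qed.

(** By [defect_pythagoras] at [Phi = 0], the squared norm of [Psi_star] in L^2 is
    at most the defect of 0, the second moment of [mu] along [Es]. *)
Lemma L2_Psi_star : L2_space mu (Psi_star mu_).
Proof.
split; first exact: measurable_Psi_star.
apply: le_lt_trans defect0_lty; rewrite [leRHS]defect_pythagoras//.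
have sub_zero xi : cnorm (vsval (Psi_star mu_ xi)) =
    cnorm (vsval (Psi_star mu_ xi) - vsval (0 : subvs_of (Es e m))).
  by congr cnorm; exact/esym/subr0.
under eq_integral do rewrite sub_zero.
by rewrite leeDr//; apply: integral_ge0 => y _; rewrite lee_fin sqr_ge0.
Qed.

Lemma optimal_Psi_star : optimal_parameterization mu (Psi_star mu_).
Proof.
split=> [|Phi [mPhi _]]; first exact: L2_Psi_star.
rewrite (defect_pythagoras mPhi); split.
  by rewrite leeDl//; apply: integral_ge0 => xi _; rewrite lee_fin sqr_ge0.
set D := (X in (_ + X)%E) => dPhi.
have D0 : D = 0%E.
  move: dPhi defect_Psi_star_lty.
  have : (0 <= defect mu (Psi_star mu_))%E.
    by apply: integral_ge0 => y _; rewrite lee_fin sqr_ge0.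
  move: (defect mu _) D => [r| |] [s| |]//= _ [] /eqP.
  by rewrite -subr_eq0 addrAC subrr add0r => /eqP ->.
have mPP := measurable_sqr_cnormB measurable_Psi_star mPhi.
have := (ae_eq_integral_abs (mfrak e m mu) measurableT mPP).1.
under eq_integral do rewrite gee0_abs ?lee_fin ?sqr_ge0//.
move=> /(_ D0); apply: filterS => xi /(_ I) [].
move=> /sqr_cnorm_eq0/eqP; rewrite subr_eq0 => /eqP /subvs_inj.
exact: esym.
Qed.

End optimality.

(** * Conditional expectation of the vector field *)

Theorem theorem5 (R : realType) (N m : nat)
  (A : 'M[R[i]]_N)
  (B : {bilinear 'cV[R[i]]_N -> 'cV[R[i]]_N -> 'cV[R[i]]_N})
  (F : 'cV[R[i]]_N)
  (beta : 'I_N -> R[i]) (e : 'I_N -> 'cV[R[i]]_N)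
  (T : R -> 'cV[R[i]]_N -> 'cV[R[i]]_N)
  (mu : probability 'cV[R[i]]_N R)
  (mu_ : R.-pker (subvs_of (Ec e m)) ~> (subvs_of (Es e m))) :
  (1 <= m < N)%N ->
  spectral_setting e m A beta ->
  is_flow (vector_field A B F) T ->
  invariant_measure T mu ->
  physically_relevant T mu ->
  is_disintegration mu mu_ ->
  (\int[mu]_y (cnorm (vsval (Pis e m y)) ^+ 2)%:E < +oo)%E ->
  [/\ optimal_parameterization mu (Psi_star mu_),
      {ae mfrak e m mu, forall xi : subvs_of (Ec e m),
        [/\ vintegrable (mu_ xi) (fun zeta => zeta),
            vintegrable (mu_ xi) (fun zeta =>
              Pic e m (vector_field A B F (vsval xi + vsval zeta))),
            vintegrable (mu_ xi) (fun zeta =>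
              Pic e m (B (vsval zeta) (vsval zeta))) &
            cond_expectation mu_ (vector_field A B F) xi =
              Pic e m (A *m vsval xi) + Pic e m (B (vsval xi) (vsval xi))
              + Pic e m (B (vsval xi) (vsval (Psi_star mu_ xi))
                         + B (vsval (Psi_star mu_ xi)) (vsval xi))
              + Pic e m F + eta_term mu_ B xi]} &
      {ae mfrak e m mu, forall xi, eta_term mu_ B xi = 0} ->
      {ae mfrak e m mu, forall xi : subvs_of (Ec e m),
        cond_expectation mu_ (vector_field A B F) xi =
          Pic e m (A *m vsval xi) + Pic e m (B (vsval xi) (vsval xi))
          + Pic e m (B (vsval xi) (vsval (Psi_star mu_ xi))
                     + B (vsval (Psi_star mu_ xi)) (vsval xi))
          + Pic e m F}].
Proof.
move=> mN sA _ _ _ dis mu2.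
set fiber_formula := (X in [/\ _, X & _]).
suff ff : fiber_formula.
  split; [exact: optimal_Psi_star | exact: ff |].
  move=> eta0; apply: filterS2 ff eta0 => xi [_ _ _ ->] ->.
  exact: addr0.
apply: filterS (ae_fiber_sqr_integrable dis mu2) => xi xi2.
have mv := @measurable_vsval R N (Es e m).
pose L : {linear _ -> _} := vsval \o Defs.proj (Ec e m) (Es e m).
split.
- exact: (cintegrable_sqr mv xi2).
- exact: (cintegrable_linear L (cintegrable_vector_field A B F xi2 _)).
- exact: (cintegrable_linear L (cintegrable_bilinear_sqr mv xi2 B)).
- exact: (vint_proj_vector_field B F xi2 (Ec_cap_Es sA) (Ec_add_Es sA)
    (Es_stable mN sA)).
Qed.
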